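(* Let $X$ be a compact metric countable space with metric $d$ and let $f:X\to X$ be a homeomorphism. Then the following are equivalent: \begin{enumerate} \item[(i)] $(X,f)$ is equicontinuous. \item[(ii)] $(X,f)$ is distal. \item[(iii)] Every point of $X$ is periodic. \item[(iv)] There is a non-principal ultrafilter $p\in\mathbb{N}^*$ such that $f^p$ is a homeomorphism. \item[(v)] For all $\varepsilon>0$ there is an integer $l\geq 1$ such that $d(x,f^{nl}(x))<\varepsilon$ for all $x\in X$ and all $n\in\mathbb{N}$. \item[(vi)] $E(X,f,\mathbb{Z})=\overline{\{f^n:\ n\in\mathbb{N}\}}$. \end{enumerate}
   Context: $\mathbb{N}$ is the set of non-negative integers. $\beta\mathbb{N}$ is the set of all ultrafilters on $\mathbb{N}$ (each $n\in\mathbb{N}$ identified with the principal ultrafilter at $n$), and $\mathbb{N}^*=\beta\mathbb{N}\setminus\mathbb{N}$ is the set of non-principal ultrafilters. For $p\in\beta\mathbb{N}$ and a sequence $(x_n)_n$ in $X$, $x=p\text{-}\lim_n x_n$ means that $\{n\in\mathbb{N}: x_n\in V\}\in p$ for every neighborhood $V$ of $x$; since $X$ is compact metric this limit exists and is unique. The $p$-iterate of $f$ is the function $f^p:X\to X$, $f^p(x)=p\text{-}\lim_n f^n(x)$. A point $x$ is periodic if $f^n(x)=x$ for some $n\ge 1$. $E(X,f,\mathbb{Z})$ is the closure of $\{f^n:n\in\mathbb{Z}\}$ in $X^X$ with the product topology; the closure in (vi) is also taken in $X^X$ with the product topology. $(X,f)$ is distal if $\inf\{d(f^n(x),f^n(y)):n\in\mathbb{Z}\}>0$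 for every pair of different points $x,y\in X$. $(X,f)$ is equicontinuous if for every $\varepsilon>0$ there is $\delta>0$ such that for all $x,y\in X$ with $d(x,y)<\delta$ we have $d(f^n(x),f^n(y))<\varepsilon$ for all $n\in\mathbb{Z}$. *)

(* Defs.v *)
From HB Require Import structures.
From mathcomp Require Import all_boot all_order all_algebra.
From mathcomp Require Import all_classical all_reals all_analysis.

Set Implicit Arguments.
Unset Strict Implicit.
Unset Printing Implicit Defensive.

Import Order.TTheory GRing.Theory Num.Theory.

Local Open Scope classical_set_scope.
Local Open Scope ring_scope.

Definition homeomorphism (X Y : topologicalType) (f : X -> Y) : Prop :=
  exists g : Y -> X,
    [/\ continuous f, continuous g, cancel f g & cancel g f].

(* The iterate f^n for n : int. For bijective f, 'pinv_id [set: X] f is the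
   two-sided inverse of f; otherwise the negative iterates are junk. Recall
   that Negz m stands for the integer - m.+1. *)
Definition ziter (X : choiceType) (f : X -> X) (n : int) : X -> X :=
  match n with
  | Posz m => iter m f
  | Negz m => iter m.+1 ('pinv_id [set: X] f)
  end.

Definition nonprincipal_ultrafilter (T : Type) (p : set_system T) : Prop :=
  UltraFilter p /\ forall t : T, p <> principal_filter t.

(* u @ p --> x says that u @^-1` V \in p for every neighborhood V of x, that
   is, x = p-lim u. The default value of xget is only used when the p-limit
   does not exist, which cannot happen in a compact space. *)
Definition piter (X : topologicalType) (f : X -> X) (p : set_system nat) :
    X -> X :=
  fun x => xget x [set y : X | (fun n : nat => iter n f x) @ p --> y].

Definition periodic_point (X : Type) (f : X -> X) (x : X) : Prop :=
  exists2 n : nat, (1 <= n)%N & iter n f x = x.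

(* mathcomp-analysis' equicontinuous is the pointwise notion; this is the
   uniform one, for the family of all integer iterates of f. *)
Definition equicontinuous_system (R : realType) (X : metricType R)
    (f : X -> X) : Prop :=
  forall e : R, 0 < e -> exists2 delta : R, 0 < delta &
    forall x y : X, mdist x y < delta ->
    forall n : int, mdist (ziter f n x) (ziter f n y) < e.

Definition distal_system (R : realType) (X : metricType R)
    (f : X -> X) : Prop :=
  forall x y : X, x != y ->
    0 < inf [set mdist (ziter f n x) (ziter f n y) | n in [set: int]].

Definition ellis_Z (X : topologicalType) (f : X -> X) : set {ptws X -> X} :=
  closure ([set ziter f n | n in [set: int]] : set {ptws X -> X}).

Definition forward_orbit_closure (X : topologicalType) (f : X -> X) :
    set {ptws X -> X} :=
  closure ([set iter n f | n in [set: nat]] : set {ptws X -> X}).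

(* Main.v *)
Require Import Defs.
From mathcomp Require Import all_boot all_order all_algebra.
From mathcomp Require Import all_classical all_reals all_analysis.
From mathcomp Require Import lra.

(**
Countability is used through two facts. By Baire's theorem a countable compact
metric space is scattered: each of its nonempty subsets A has an isolated
point, that is, some x in A with a neighborhood V such that V meets A in x
only ([countable_compact_scattered]). Moreover such a space has a basis of
clopen sets ([countable_metric_clopen]), since around a given point all but
countably many radii are the distance of no point.

Suppose that some point is not periodic, and let x be isolated in the set P of
all nonperiodic points, say V meets P in x only.
- If g = f^p is a homeomorphism for a nonprincipal p, then g commutes with f,
  hence g^-1 preserves P, and g x, the p-limit of the f^n x, is isolated in P.
  Thus f^n x = g x for p-almost all n, and in particular for two different n.
  So x is periodic, a contradiction.
- If f^-1 is a pointwise limit of the f^n with n >= 0, then f (f^n x) lies in V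
  for some n, and being nonperiodic it is x, a contradiction.
So both conditions imply that all points are periodic.

Distality implies it too: the forward orbit closure of a point x contains a
minimal set, whose isolated point z is visited again by its own orbit, hence is
periodic. If x were not in the finite orbit of z then, by distality, the f^n x
would stay at distance at least e > 0 from this orbit, which contradicts that
they accumulate at z.

For the way back, assume that all points are periodic. The main point is that
f is stable at each z ([pointwise_stability]). Let g be the iterate of f that fixes z, and U a clopen
neighborhood of z. A point y outside of U is periodic, so some g^-j y with
j >= 1 is outside of U; by compactness of the complement of U a bounded j
suffices, j <= N. Therefore an orbit of g that spends N + 1 consecutive times in
U never leaves U ([clopen_trap]), and every point close to z has such an orbit.
Compactness turns stability at each point into equicontinuity and into the
uniform return times l. Moreover f^(n!) x = x for large n, so f^p is the identity
if p refines the filter of the sequence n!.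

Finally, if l is a uniform return time then f^(k l - k) is uniformly close to
f^-k, so f^-k is a pointwise limit of forward iterates; and equicontinuity implies
distality by applying f^-n.
*)

Set Implicit Arguments.
Unset Strict Implicit.
Unset Printing Implicit Defensive.

Import Order.TTheory GRing.Theory Num.Theory.
Import metricType_numDomainType.

Local Open Scope classical_set_scope.
Local Open Scope ring_scope.

(** * Countable compact metric spaces *)

Section countable_metric_spaces.
Context {R : realType} {X : metricType R}.
Implicit Types (x y : X) (A V : set X) (e r : R).

Lemma near_mdist x e : 0 < e -> \forall y \near x, mdist x y < e.
Proof. by move=> e0; apply/nbhs_mdistP; exists e. Qed.

Lemma nbhs_mdist_lt x V : nbhs x V ->
  exists2 e : R, 0 < e & forall y, mdist x y < e -> V y.
Proof. by move=> /nbhs_mdistP[e e0 eV]; exists e. Qed.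

Lemma mdist_isolated A x e : A x -> 0 < e ->
  (forall y, A y -> mdist x y < e -> y = x) -> isolated A x.
Proof.
move=> Ax e0 Ae; split; first exact: mem_set.
exists [set y | mdist x y < e]; first exact: near_mdist.
apply/seteqP; split=> [y [/= ye Ay]|y ->]; first exact: Ae.
by split=> //=; rewrite mdistxx.
Qed.

(** Baire's argument. If no point of A is isolated then, whatever ball is given,
some smaller ball centered in A misses the n-th point of A. The centers of a
nested sequence of such balls accumulate at a point of A that all balls contain,
although this point is missed when its turn comes in the enumeration. *)
Lemma compact_countable_isolated A : compact A -> countable A -> A !=set0 ->
  isolated A !=set0.
Proof.
move=> cA /countable_injP[num num_inj] [a0 Aa0].
have [//|noiso] := pselect (isolated A !=set0); exfalso.
have close c r : A c -> 0 < r -> exists2 b, A b & mdist c b < r /\ b != c.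
  move=> Ac r0; apply: contrapT => no; apply: noiso; exists c.
  apply: (mdist_isolated Ac r0) => y Ay yr; apply/eqP/negP => /negP yc.
  by apply: no; exists y.
(* The third condition makes the new closed ball a subset of the old one, by the
   triangle inequality. *)
have step (t : nat * (X * R)) : exists s : X * R,
    A t.2.1 -> 0 < t.2.2 ->
    [/\ A s.1, 0 < s.2, mdist t.2.1 s.1 + s.2 <= t.2.2 &
       forall a, A a -> num a = t.1 -> s.2 < mdist s.1 a].
  case: t => n [c r] /=.
  have [Ac|] := pselect (A c); last by exists (c, r).
  have [r0|] := pselect (0 < r); last by exists (c, r).
  (* The new center has to differ from the n-th point; the old one is kept if it
     already does. *)
  have [b [Ab cb nb]] : exists b, [/\ A b, mdist c b < r & num b != n].
    have [cn|cn] := eqVneq (num c) n; last by exists c; rewrite mdistxx.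
    have [b Ab [cb bc]] := close _ _ Ac r0; exists b; split=> //.
    apply: contra_neq bc => bn; apply: num_inj; rewrite ?inE//.
    by rewrite bn cn.
  have [[a Aa an]|no] := pselect (exists2 a, A a & num a = n); last first.
    exists (b, r - mdist c b) => _ _ /=; split=> //; rewrite ?subr_gt0//.
      by rewrite subrKC.
    by move=> a Aa an; exfalso; apply: no; exists a.
  have ba : 0 < mdist b a.
    by rewrite mdist_gt0; apply: contra_neq nb => ->.
  exists (b, Num.min (r - mdist c b) (mdist b a / 2)) => _ _ /=; split=> //.
  - by rewrite lt_min subr_gt0 cb divr_gt0.
  - by rewrite -lerBrDl ge_min lexx.
  - move=> a' Aa' a'n; rewrite (_ : a' = a); last first.
      by apply: num_inj; rewrite ?inE// a'n an.
    by rewrite gt_min; apply/orP; right; lra.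
have [next nextP] := choice step.
pose s := fix s n := if n is m.+1 then next (m, s m) else (a0, 1).
have sP n : A (s n).1 /\ 0 < (s n).2.
  by elim: n => [|n [An rn]] //=; have [] := nextP (n, s n) An rn.
have s_close m n : (n <= m)%N -> mdist (s n).1 (s m).1 + (s m).2 <= (s n).2.
  elim: m => [|m IH]; first by rewrite leqn0 => /eqP ->; rewrite mdistxx add0r.
  rewrite leq_eqVlt => /orP[/eqP ->|]; first by rewrite mdistxx add0r.
  move=> /IH nm; have [Am rm] := sP m.
  have [_ _ /= + _] := nextP (m, s m) Am rm.
  have := metric_triangle (s n).1 (s m).1 (s m.+1).1 => /=; lra.
have [|a [Aa cla]] := cA ((fun n => (s n).1) @ \oo).
  by exists 0%N => // n _; exact: (sP n).1.
have a_in n : mdist (s n).1 a <= (s n).2.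
  rewrite leNgt; apply/negP => lt.
  have e0 : 0 < mdist (s n).1 a - (s n).2 by rewrite subr_gt0.
  have tail : ((fun n => (s n).1) @ \oo)
      [set (s m).1 | m in [set m | (n <= m)%N]].
    by exists n => // m /= nm; exists m.
  have [_ [[m /= nm <-] am]] := cla _ _ tail (near_mdist a e0).
  have := s_close _ _ nm; have := metric_triangle (s n).1 (s m).1 a.
  rewrite /= metric_sym in am; have := (sP m).2; lra.
have [An rn] := sP (num a).
have [_ _ _ /(_ a Aa erefl)] := nextP (num a, s (num a)) An rn.
by rewrite ltNge => /negP; apply; exact: (a_in (num a).+1).
Qed.

(** The ball around x with radius r is clopen if no point is at distance r of x.
Such an r exists below any e > 0 because the interval ]0, e[ has positive
Lebesgue measure and thus is uncountable. *)
Lemma countable_metric_clopen x V : countable [set: X] -> nbhs x V ->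
  exists U : set X, [/\ clopen U, U x & U `<=` V].
Proof.
move=> cX /nbhs_mdist_lt[e e0 eV].
have [r r0e rd] : exists2 r, 0 < r < e & forall y, mdist x y != r.
  apply: contrapT => no.
  have sub : `]0, e[ `<=` [set mdist x y | y in [set: X]].
    move=> r /=; rewrite in_itv/= => r0e; apply: contrapT => xr.
    apply: no; exists r => // y; apply/eqP => yr; apply: xr; by exists y.
  have cI : countable (`]0, e[ : set R).
    apply: sub_countable (subset_card_le sub) _.
    exact: sub_countable (card_image_le _ _) cX.
  have := countable_lebesgue_measure0 cI.
  rewrite lebesgue_measure_itv/= lte_fin e0 sube0 => -[] /eqP.
  by rewrite gt_eqF.
have cts (y : X) d : 0 < d -> \forall z \near y, `|mdist x y - mdist x z| < d.
  move=> d0; near=> z.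
  have yz : mdist y z < d by near: z; exact: near_mdist.
  have := metric_triangle x y z; have := metric_triangle x z y.
  rewrite (metric_sym z y) => ? ?; rewrite ltr_norml; lra.
move/andP : r0e => [r0 re].
exists [set y | mdist x y < r]; split=> /=; last 2 first.
- by rewrite mdistxx.
- by move=> y /= yr; apply: eV => /=; exact: lt_trans re.
split.
- rewrite openE => y /= yr; have := cts y (r - mdist x y).
  rewrite subr_gt0 => /(_ yr); apply: filterS => z.
  by rewrite /= ltr_norml; lra.
- rewrite -openC openE => y /= /negP; rewrite -leNgt le_eqVlt eq_sym.
  rewrite (negbTE (rd y)) /= => yr; have := cts y (mdist x y - r).
  rewrite subr_gt0 => /(_ yr); apply: filterS => z.
  rewrite /= ltr_norml => ?; apply/negP; rewrite -leNgt; lra.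
Unshelve. all: by end_near. Qed.

End countable_metric_spaces.

Section scattered_spaces.
Context {R : realType} {X : metricType R}.
Hypotheses (cptX : compact [set: X]) (ctbX : countable [set: X]).

(** Baire's argument applies to the closure of A; an isolated point of the
closure belongs to A, since every neighborhood of it meets A. *)
Lemma countable_compact_scattered (A : set X) : A !=set0 -> isolated A !=set0.
Proof.
move=> [a Aa].
have cA : compact (closure A).
  exact: subclosed_compact (@closed_closure _ _) cptX (@subsetT _ _).
have ctA : countable (closure A).
  exact: sub_countable (subset_card_le (@subsetT _ _)) ctbX.
have [|x [/set_mem clx [V Vx VA]]] := compact_countable_isolated cA ctA.
  by exists a; exact: subset_closure.
have [y [Ay Vy]] := clx _ Vx.
have yx : y = x.
  have : (V `&` closure A) y by split=> //; exact: subset_closure.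
  by rewrite VA.
exists x; split; first by apply: mem_set; rewrite -yx.
exists V => //; apply/seteqP; split=> [z [Vz Az]|z ->].
  by rewrite -VA; split=> //; exact: subset_closure.
by split; [exact: nbhs_singleton|rewrite -yx].
Qed.

End scattered_spaces.

(** * Iterates and periodic points *)

Section iterates_type.
Context {T : Type}.
Implicit Types (f g h : T -> T) (x : T).

Lemma iter_cancel g h n : cancel g h -> cancel (iter n g) (iter n h).
Proof. by move=> gK; elim: n => // n IH x; rewrite iterSr iterS gK IH. Qed.

Lemma iter_comm f g n x : (forall y, g (f y) = f (g y)) ->
  g (iter n f x) = iter n f (g x).
Proof. by move=> gf; elim: n => //= n <-; rewrite gf. Qed.

Lemma iter_fixed f x n k : iter k f x = x -> iter (n * k) f x = x.
Proof. by move=> kx; rewrite iterM; elim: n => //= n ->. Qed.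

Lemma iter_fixed_dvdn f x k n : (k %| n)%N -> iter k f x = x -> iter n f x = x.
Proof. by move=> /dvdnP[q ->]; exact: iter_fixed. Qed.

Lemma iter_modn f x n k : iter k f x = x -> iter (n %% k) f x = iter n f x.
Proof.
by move=> kx; rewrite {2}(divn_eq n k) addnC iterD iter_fixed.
Qed.

Lemma periodic_iter_eq f h x m n : cancel f h -> m != n ->
  iter m f x = iter n f x -> periodic_point f x.
Proof.
move=> fK; wlog mn : m n / (m < n)%N => [wlog_mn mn emn|_ emn].
  have [lt|lt|eq] := ltngtP m n; last by rewrite eq eqxx in mn.
    exact: wlog_mn lt mn emn.
  by apply: wlog_mn lt _ (esym emn); rewrite eq_sym.
exists (n - m)%N; first by rewrite subn_gt0.
apply: (can_inj (iter_cancel m fK)).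
by rewrite -iterD subnKC// ltnW.
Qed.

Lemma periodic_iter f h n x : cancel f h ->
  periodic_point f (iter n f x) -> periodic_point f x.
Proof.
move=> fK [k k1]; rewrite -iterD => kx.
apply: (periodic_iter_eq (m := k + n) (n := n) fK) => //.
by rewrite -[X in _ != X]add0n eqn_add2r -lt0n.
Qed.

Lemma periodic_inverse f h x : cancel f h ->
  periodic_point f x -> periodic_point h x.
Proof.
by move=> fK [k k1 kx]; exists k => //; rewrite -{1}kx (iter_cancel k fK).
Qed.

Lemma periodic_comp f k x : (0 < k)%N ->
  periodic_point f x -> periodic_point (iter k f) x.
Proof.
by move=> k0 [j j1 jx]; exists j => //; rewrite -iterM mulnC; exact: iter_fixed.
Qed.

End iterates_type.

(** * Minimal sets and trapping sets *)

Section iterates.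
Context {T : topologicalType}.
Implicit Types f g h : T -> T.

Lemma continuous_iter f n : continuous f -> continuous (iter n f).
Proof.
move=> cf; elim: n => [|n IH] x; first exact: cvg_id.
exact: cvg_comp (IH x) (cf _).
Qed.

Lemma near_iter f n x (V : set T) : continuous f -> nbhs (iter n f x) V ->
  \forall y \near x, V (iter n f y).
Proof. by move=> cf; exact: (@continuous_iter f n cf x V). Qed.

Lemma closure_orbit_invariant f x y : continuous f ->
  closure (range (fun n => iter n f x)) y ->
  closure (range (fun n => iter n f x)) (f y).
Proof.
move=> cf cly V /cf Vy; have [_ [[n _ <-] Vn]] := cly _ Vy.
by exists (iter n.+1 f x); split=> //; exists n.+1.
Qed.

(** Zorn's lemma is applied to the complements: open sets that do not cover A
and whose complement is invariant. The union of a chain of them does not cover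
A, as one of the sets would cover the compact A already. *)
Lemma minimal_invariant_set f (A : set T) : compact A -> closed A ->
    A !=set0 -> {homo f : x / A x} ->
  exists M : set T, [/\ closed M, M !=set0, M `<=` A, {homo f : x / M x} &
    forall K, closed K -> K !=set0 -> K `<=` M -> {homo f : x / K x} ->
      M `<=` K].
Proof.
move=> cptA clA [a Aa] fA.
pose P (U : set T) := [/\ open U, f @^-1` U `<=` U & ~ A `<=` U].
have [F FP Ftot|U [[oU fU AU] Umax]] := @Zorn_bigcup _ P.
  split.
  - by apply: bigcup_open => U /FP[].
  - by move=> x [U FU Ufx]; exists U => //; have [_ + _] := FP _ FU; exact.
  - move=> AF; have [U0 FU0 _] := AF _ Aa.
    (* The filter of the tails of the chain F. *)
    pose G := filter_from F (fun U => [set V | F V /\ U `<=` V]).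
    have GF : ProperFilter G.
      apply: filter_from_proper; last by move=> U FU; exists U; split.
      apply: filter_from_filter; first by exists U0.
      move=> U V FU FV; have [UV|VU] := Ftot _ _ FU FV.
        exists V => // W [FW VW].
        by split; split=> //; apply: subset_trans UV _.
      by exists U => // W [FW UW]; split; split=> //; apply: subset_trans VU _.
    have := (compact_near_coveringP A).1 cptA _ G (fun V x => V x) _.
    have /[swap] /[apply] : forall x, A x ->
        \forall x' \near x & V \near G, V x'.
      move=> x /AF [U FU Ux]; exists (U, [set V | F V /\ U `<=` V]) => /=.
        split; last by exists U.
        by apply: open_nbhs_nbhs; split=> //; have [] := FP _ FU.
      by move=> [y V] /= [Uy [_ UV]]; exact: UV.
    have FG : \near G, F G by exists U0 => // V [].
    move=> AG; have [V [FV AV]] := filter_ex (filterI FG AG).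
    by have [] := FP _ FV.
exists (A `&` ~` U); split.
- by apply: closedI => //; exact: open_closedC.
- by move: AU => /existsNP[x /not_implyP[Ax Ux]]; exists x.
- exact: subIsetl.
- by move=> x [Ax Ux]; split; [exact: fA|move=> /fU].
- move=> K clK [k Kk] KM fK x [Ax Ux]; apply: contrapT => Kx.
  apply: (Umax (~` K)).
    split; last by move=> /(_ x Kx).
    by move=> y Uy Ky; have [_] := KM _ Ky.
  split; first exact: closed_openC.
  + by move=> y /= Kfy Ky; apply/Kfy/fK.
  + by move=> AK; have [Ak _] := KM _ Kk; exact: AK Kk.
Qed.

(** Here h plays the role of the inverse of g. By periodicity each point outside
of U was outside of U at some earlier time, and by compactness at most N steps
earlier, with N independent of the point. So the first exit from U cannot come
after time N. Openness of the complement of U makes the number of steps locally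
constant, and its closedness makes the complement compact. *)
Lemma clopen_trap g h (U : set T) : compact [set: T] -> continuous h ->
    cancel g h -> (forall x, periodic_point h x) -> clopen U ->
  exists N, forall x, (forall j, (j <= N)%N -> U (iter j g x)) ->
    forall n, U (iter n g x).
Proof.
move=> cT ch gK hper [oU cU].
have cptU : compact (~` U).
  exact: subclosed_compact (open_closedC oU) cT (@subsetT _ _).
have /(_ _) := (compact_near_coveringP _).1 cptU _ \oo
  (fun N y => exists2 j, (1 <= j <= N)%N & ~ U (iter j h y)) _.
have /[swap] /[apply] : forall y, (~` U) y -> \forall y' \near y & N \near \oo,
    exists2 j, (1 <= j <= N)%N & ~ U (iter j h y').
  move=> y Uy; have [j j1 jy] := hper y.
  exists (iter j h @^-1` (~` U), [set N | (j <= N)%N]) => /=.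
    split; last by exists j.
    apply: (near_iter ch); rewrite jy.
    by apply: open_nbhs_nbhs; split=> //; exact: closed_openC.
  by move=> [y' N] /= [Uy' jN]; exists j; rewrite ?j1.
move=> [N _ /(_ N (leqnn N)) NU]; exists N => x xU n.
elim/ltn_ind: n => n IH; have [/xU//|Nn] := leqP n N.
apply: contrapT => /NU [j /andP[j1 jN]]; apply.
have jn : (j <= n)%N by exact: leq_trans jN (ltnW Nn).
rewrite -{1}(subnKC jn) iterD.
rewrite (iter_cancel _ gK); apply: IH.
by rewrite ltn_subrL j1 (leq_trans j1 jn).
Qed.

End iterates.

(** * Integer iterates *)

Section integer_iterates.
Context {X : choiceType} {f h : X -> X}.
Hypotheses (fK : cancel f h) (hK : cancel h f).

Lemma pinv_inverse : 'pinv_id [set: X] f = h.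
Proof.
apply/funext => x; apply: (can_inj fK); rewrite hK pinvK//.
by apply: mem_set; exists (h x).
Qed.

Lemma ziter_Negz m : ziter f (Negz m) = iter m.+1 h.
Proof. by rewrite /ziter pinv_inverse. Qed.

Lemma ziter_opp (n : int) : cancel (ziter f n) (ziter f (- n)).
Proof.
case: n => [[|m]|m] x.
- by rewrite oppr0.
- by rewrite -NegzE ziter_Negz (iter_cancel _ fK).
- by rewrite NegzE opprK -NegzE ziter_Negz; exact: (iter_cancel m.+1 hK).
Qed.

(** The order of the quantifiers matters: m does not depend on x, so an integer
iterate becomes the same forward iterate at all points with the common period
N. *)
Lemma ziter_periodic N (n : int) : (0 < N)%N ->
  exists m, forall x, iter N f x = x -> ziter f n x = iter m f x.
Proof.
move=> N0; case: n => [m|m]; first by exists m.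
(* - (m + 1) is congruent to (m + 1) (N - 1) modulo N. *)
exists (m.+1 * N.-1)%N => x xN; rewrite ziter_Negz.
apply: (can_inj (iter_cancel m.+1 fK)); rewrite (iter_cancel _ hK) -iterD.
by rewrite -mulnS prednK// iter_fixed.
Qed.

End integer_iterates.

(** * Limits along ultrafilters *)

Section p_limits.
Context {R : realType} {X : metricType R}.
Implicit Types (f : X -> X) (p : set_system nat).

Lemma piter_eq f p x y : ProperFilter p ->
  (fun n => iter n f x) @ p --> y -> piter f p x = y.
Proof.
move=> pp xy; apply: xget_unique => // z /= xz.
exact: (cvg_unique (@metric_hausdorff _ _) xz xy).
Qed.

Lemma piter_cvg f p x : compact [set: X] -> UltraFilter p ->
  (fun n => iter n f x) @ p --> piter f p x.
Proof.
move=> cX pU; apply: (@xgetPex _ _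
  [set y : X | (fun n : nat => iter n f x) @ p --> y]).
have [|y [_ cly]] := cX ((fun n => iter n f x) @ p) _; first exact: filterT.
exists y => /= V Vy; rewrite nbhs_simpl /=.
have [//|nV] := in_ultra_setVsetC ((fun n => iter n f x) @^-1` V) pU.
by have [z []] := cly _ _ (nV : ((fun n => iter n f x) @ p) (~` V)) Vy.
Qed.

Lemma piter_comm f p x : compact [set: X] -> UltraFilter p -> continuous f ->
  piter f p (f x) = f (piter f p x).
Proof.
move=> cX pU cf; apply: piter_eq.
have -> : (fun n => iter n f (f x)) = f \o (fun n => iter n f x).
  by apply/funext => n; rewrite -iterSr.
by apply: cvg_comp; [exact: piter_cvg|exact: cf].
Qed.

(** An ultrafilter that contains a singleton is principal. *)
Lemma nonprincipal_neq p t : nonprincipal_ultrafilter p -> p (~` [set t]).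
Proof.
move=> [pU np]; have [pt|//] := in_ultra_setVsetC [set t] pU.
exfalso; apply: (np t); apply/esym.
apply: max_filter; first exact: principal_filter_proper.
move=> U pU'; apply/principal_filterP.
by have [s [Us /= <-]] := filter_ex (filterI pU' pt).
Qed.

End p_limits.

(** * Periodicity from distality and from p-iterates *)

Section homeomorphisms.
Context {R : realType} {X : metricType R} {f h : X -> X}.
Hypotheses (cptX : compact [set: X]) (ctbX : countable [set: X]).
Hypotheses (cf : continuous f) (ch : continuous h).
Hypotheses (fK : cancel f h) (hK : cancel h f).

Lemma equicontinuous_distal : equicontinuous_system f -> distal_system f.
Proof.
move=> ef x y xy; have d0 : 0 < mdist x y by rewrite mdist_gt0.
have [d dgt0 df] := ef _ d0.
apply: (lt_le_trans dgt0); apply: lb_le_inf.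
  by exists (mdist (ziter f 0 x) (ziter f 0 y)), 0.
move=> _ [n _ <-]; rewrite leNgt; apply/negP => /df /(_ (- n)).
by rewrite !(ziter_opp fK hK) ltxx.
Qed.

(** Inside the invariant set there is a minimal one, M, and M has an isolated
point z. The orbit closure of f z is all of M by minimality, so the orbit of f z
comes arbitrarily close to z, which means that it returns to z. *)
Lemma periodic_in_invariant_set (A : set X) : closed A -> A !=set0 ->
  {homo f : x / A x} -> A `&` periodic_point f !=set0.
Proof.
move=> clA A0 fA.
have cptA : compact A := subclosed_compact clA cptX (@subsetT _ _).
have [M [clM M0 MA fM Mmin]] := minimal_invariant_set cptA clA A0 fA.
have [z [/set_mem Mz [V Vz VM]]] := countable_compact_scattered cptX ctbX M0.
exists z; split; first exact: MA.
pose O := range (fun n => iter n f (f z)).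
have OM : O `<=` M by move=> _ [n _ <-]; elim: n => /= [|n]; exact: fM.
have clO : closure O z.
  apply: (Mmin (closure O)) => //.
  - exact: closed_closure.
  - by exists (f z); apply: subset_closure; exists 0%N.
  - by rewrite (closure_id M).1//; exact: closureS.
  - by move=> y; exact: closure_orbit_invariant.
have [_ [[n _ <-] Vn]] := clO _ Vz.
have : (V `&` M) (iter n f (f z)) by split=> //; apply: OM; exists n.
by rewrite VM /= -iterSr => zn; exists n.+1.
Qed.

(** The orbit closure of x contains a periodic point z. If x avoided the orbit
of z, distality would keep f^n x at distance more than e from f^n w for all n and
all of the finitely many w in the orbit of z, with a uniform e. But f^n x comes
within e of z, and z is f^n w for some such w. *)
Lemma distal_periodic : distal_system f -> forall x, periodic_point f x.
Proof.
move=> df x.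
have [||z [clz [k k1 kz]]] := @periodic_in_invariant_set
    (closure (range (fun n => iter n f x))) (@closed_closure _ _).
- by exists x; apply: subset_closure; exists 0%N.
- by move=> y; exact: closure_orbit_invariant.
apply: contrapT => xnp.
have xz j : x != iter j f z.
  apply/eqP => xj; apply: xnp; exists k => //.
  by rewrite xj -iterD addnC iterD kz.
have : \forall e \near 0^'+, forall j : 'I_k, e <
    inf [set mdist (ziter f n x) (ziter f n (iter j f z)) | n in [set: int]].
  apply: filter_forall => j; apply: nbhs_right_lt; exact: df.
move=> /(filterI (nbhs_right_gt 0)) /filter_ex [e [e0 esmall]].
have [_ [[n _ <-] zn]] := clz _ (near_mdist z e0).
(* The point of the orbit of z that f^n takes to z: n + n (k - 1) is a multiple
   of the period k. *)
pose j := Ordinal (ltn_pmod (n * k.-1) k1).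
have jz : iter n f (iter j f z) = z.
  by rewrite /= iter_modn// -iterD -mulnS prednK// iter_fixed.
suff : e < mdist (iter n f x) z by rewrite metric_sym ltNge (ltW zn).
apply: lt_le_trans (esmall j) _; apply: ge_inf.
  by exists 0 => _ [m _ <-]; exact: mdist_ge0.
by exists (n : int) => //; rewrite -[X in _ = mdist _ X]jz.
Qed.

Lemma nonperiodic_isolated : ~ (forall x, periodic_point f x) ->
  isolated (~` periodic_point f) !=set0.
Proof.
by move=> /existsNP[x nx]; apply: countable_compact_scattered => //; exists x.
Qed.

(** Since f^p commutes with f, its inverse gi preserves nonperiodicity. If V
isolates x among the nonperiodic points, the preimage of V under gi therefore
isolates f^p x. The points f^n x are nonperiodic and lie in it for p-almost all
n, so they are equal to f^p x. *)
Lemma periodic_of_piter_homeomorphism p : nonprincipal_ultrafilter p ->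
  homeomorphism (piter f p) -> forall x, periodic_point f x.
Proof.
move=> np [gi [cg cgi gK giK]]; apply: contrapT => /nonperiodic_isolated.
set g := piter f p in cg gK giK * => -[x [/set_mem nx [V Vx VP]]].
have pU : UltraFilter p by case: np.
have gf y : g (f y) = f (g y) by exact: piter_comm.
have near_x : p [set n | iter n f x = g x].
  have giV : nbhs (g x) (gi @^-1` V) by apply: cgi; rewrite gK.
  have pV : p [set n | V (gi (iter n f x))].
    exact: (@piter_cvg _ _ f p x cptX pU _ giV).
  apply: filterS pV => n /= Vn.
  have : (V `&` ~` periodic_point f) (gi (iter n f x)).
    split=> // -[k k1 kn]; apply: nx; apply: (periodic_iter (n := n) fK).
    exists k => //; rewrite -[iter n f x]giK.
    by rewrite -(iter_comm _ _ gf) kn.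
  by rewrite VP /= => /(congr1 g); rewrite giK.
have [m mx] := filter_ex near_x.
have [n [nx' /eqP nm]] := filter_ex (filterI near_x (nonprincipal_neq m np)).
by apply: nx; apply: (periodic_iter_eq fK nm); rewrite nx' mx.
Qed.

(** * Consequences of periodicity *)

(** The factorials are eventually multiples of every period, so along an
ultrafilter finer than their filter the p-iterate is the identity. *)
Lemma nonprincipal_piter_id : (forall x, periodic_point f x) ->
  exists p : set_system nat,
    nonprincipal_ultrafilter p /\ homeomorphism (piter f p).
Proof.
move=> per; pose F := factorial @ \oo.
have [p [pU Fp]] := ultraFilterLemma (_ : ProperFilter F).
exists p; split.
  split=> // t pt.
  have : p [set n | (t < n)%N].
    apply: Fp; exists t.+1 => // n /= tn.
    by apply: (leq_trans tn); exact: fact_geq.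
  by rewrite pt => /principal_filterP /=; rewrite ltnn.
suff -> : piter f p = id by exists id; split=> // x; exact: cvg_id.
apply/funext => x; apply: piter_eq => V Vx.
have [k k1 kx] := per x; apply: Fp; exists k => // n /= kn.
rewrite (iter_fixed_dvdn _ kx) ?dvdn_fact ?k1//; exact: nbhs_singleton.
Qed.

(** The family of iterates is equicontinuous at z. Up to the first k iterates,
which the set V controls, only g = f^k matters, with k the period of z. As g
fixes z, a whole segment of the g-orbit of a nearby point stays in a clopen
U inside V, and then the orbit is trapped in U. *)
Lemma pointwise_stability z e : (forall x, periodic_point f x) -> 0 < e ->
  \forall x \near z, forall n, mdist (iter n f z) (iter n f x) < e.
Proof.
move=> per e0; have [k k1 kz] := per z.
pose V := [set u | forall r : 'I_k, mdist (iter r f z) (iter r f u) < e].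
have Vz : nbhs z V.
  apply: filter_forall => r.
  apply: (@near_iter _ _ _ _ [set u | mdist (iter r f z) u < e] cf).
  exact: near_mdist.
have [U [clU Uz UV]] := countable_metric_clopen ctbX Vz.
have [N trap] := clopen_trap (h := iter k h) cptX (continuous_iter (n:=k) ch)
  (iter_cancel k fK) (fun x => periodic_comp k1 (periodic_inverse fK (per x)))
  clU.
have : \forall x \near z, forall j : 'I_N.+1, U (iter j (iter k f) x).
  apply: filter_forall => j.
  apply: (near_iter (continuous_iter (n:=k) cf)).
  rewrite -iterM iter_fixed//; apply: open_nbhs_nbhs; split=> //.
  by case: clU.
apply: filterS => x xU n.
have {}xU q : U (iter (q * k) f x).
  by rewrite iterM; apply: trap => j jN; exact: (xU (Ordinal (jN : j < N.+1)%N)).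
rewrite -(iter_modn n kz) {2}(divn_eq n k) [X in iter X f x]addnC iterD.
exact: (UV _ (xU _) (Ordinal (ltn_pmod n k1))).
Qed.

(** Stability at z bounds the distance of the orbits of any two points near z, and
compactness gives a radius that is valid around all points. This concerns forward
iterates; for two given points of periods j and k, every integer iterate agrees
on both with a forward one. *)
Lemma periodic_equicontinuous : (forall x, periodic_point f x) ->
  equicontinuous_system f.
Proof.
move=> per e e0; have e20 : 0 < e / 2 by rewrite divr_gt0.
pose P (d : R) x := forall y, mdist x y < d ->
  forall n, mdist (iter n f x) (iter n f y) < e.
have locP : forall z, [set: X] z -> \forall x \near z & d \near 0^'+, P d x.
  move=> z _; have /nbhs_mdist_lt[s s0 zs] := pointwise_stability z per e20.
  have s20 : 0 < s / 2 by rewrite divr_gt0.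
  near=> x d => /= y xy n.
  have zx : mdist z x < s / 2 by near: x; exact: near_mdist.
  have ds : d < s / 2 by near: d; exact: nbhs_right_lt.
  have zy : mdist z y < s by have := metric_triangle z x y; lra.
  have zx' : mdist z x < s by lra.
  have := zs _ zx' n; have := zs _ zy n.
  have := metric_triangle (iter n f x) (iter n f z) (iter n f y).
  rewrite (metric_sym (iter n f x) (iter n f z)); lra.
have nearP : \forall d \near 0^'+, [set: X] `<=` P d.
  exact: (compact_near_coveringP _).1 cptX _ _ P _ locP.
have [d [d0 dP]] := filter_ex (filterI (nbhs_right_gt 0) nearP).
exists d => // x y xy n.
have [[j j1 jx] [k k1 ky]] := (per x, per y).
have jk0 : (0 < j * k)%N by rewrite muln_gt0 j1.
have [m nm] := ziter_periodic fK hK n jk0.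
rewrite !nm; first exact: dP.
- exact: (iter_fixed_dvdn (dvdn_mull _ _) ky).
- exact: (iter_fixed_dvdn (dvdn_mulr _ _) jx).
Unshelve. all: by end_near. Qed.

(** If l is at least the period of z then all f^(n l!) fix z, hence by stability
they move the points near z only a little; by compactness one l serves for all
points. *)
Lemma periodic_uniform_return : (forall x, periodic_point f x) ->
  forall e : R, 0 < e -> exists2 l : nat, (1 <= l)%N &
    forall (x : X) (n : nat), mdist x (iter (n * l)%N f x) < e.
Proof.
move=> per e e0; have e20 : 0 < e / 2 by rewrite divr_gt0.
pose P l x := forall n, mdist x (iter (n * l`!)%N f x) < e.
have locP : forall z, [set: X] z -> \forall x \near z & l \near \oo, P l x.
  move=> z _; have [k k1 kz] := per z.
  near=> x l => /= n.
  have zx : forall n, mdist (iter n f z) (iter n f x) < e / 2.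
    by near: x; exact: pointwise_stability.
  have kl : (k <= l)%N by near: l; exists k.
  have kln : (k %| n * l`!)%N by rewrite dvdn_mull// dvdn_fact// k1.
  have := zx (n * l`!)%N; rewrite (iter_fixed_dvdn kln kz).
  have := zx 0%N; rewrite /= metric_sym.
  have := metric_triangle x z (iter (n * l`!) f x); lra.
have nearP : \forall l \near \oo, [set: X] `<=` P l.
  exact: (compact_near_coveringP _).1 cptX _ _ P _ locP.
have [l lP] := filter_ex nearP.
by exists l`!; [exact: fact_gt0|move=> x; exact: lP].
Unshelve. all: by end_near. Qed.

(** * Approximation of negative iterates by forward ones *)

(** Only f^-(m+1) has to be approximated. If all f^(n l) move points by less than e
then f^((m+1) l) is e-close to the identity, and f^((m+1) (l - 1)) is e-close to
f^-(m+1). *)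
Lemma uniform_return_ellis :
    (forall e : R, 0 < e -> exists2 l : nat, (1 <= l)%N &
      forall (x : X) (n : nat), mdist x (iter (n * l)%N f x) < e) ->
  ellis_Z f = forward_orbit_closure f.
Proof.
move=> ret; apply/seteqP; split; last first.
  by apply: closureS => _ [n _ <-]; exists (n : int).
rewrite [X in _ `<=` X](closure_id _).1; last exact: closed_closure.
apply: closureS => _ [[m|m] _ <-]; first by apply: subset_closure; exists m.
have /choice[l lP] : forall e : R, exists l, 0 < e -> (1 <= l)%N /\
    forall (x : X) (n : nat), mdist x (iter (n * l)%N f x) < e.
  move=> e; have [e0|_] := boolP (0 < e); last by exists 0%N.
  by have [l l1 lx] := ret _ e0; exists l.
pose u (e : R) : {ptws X -> X} := iter (m.+1 * (l e).-1) f.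
apply: (@closed_cvg _ _ (0 : R)^'+ _ u) => //.
- exact: closed_closure.
- by near=> e; apply: subset_closure; exists (m.+1 * (l e).-1)%N.
apply/pointwise_cvgP => t.
suff : (fun e => u e t) @ 0^'+ --> ziter f (Negz m) t by [].
apply/cvgrPdist_lt => eps eps0; near=> e.
have e0 : 0 < e by near: e; exact: nbhs_right_gt.
have [l1 lx] := lP _ e0.
rewrite (ziter_Negz fK hK); set y := iter m.+1 h t.
have -> : u e t = iter (m.+1 * l e) f y.
  by rewrite -[X in (m.+1 * X)%N](prednK l1) mulnS addnC iterD
    (iter_cancel m.+1 hK).
apply: lt_trans (lx _ _) _; near: e; exact: nbhs_right_lt.
Unshelve. all: by end_near. Qed.

(** Let V isolate x among the nonperiodic points. As f (f^-1 x) = x is in V and f^-1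
is a pointwise limit of forward iterates, some f (f^n x) is in V as well, so it is
equal to x. *)
Lemma ellis_periodic : ellis_Z f = forward_orbit_closure f ->
  forall x, periodic_point f x.
Proof.
move=> Ef; apply: contrapT => /nonperiodic_isolated.
move=> [x [/set_mem nx [V Vx VP]]].
have : ellis_Z f h.
  apply: subset_closure; exists (-1 : int) => //.
  exact: (ziter_Negz fK hK 0).
rewrite Ef => clh.
have nh : nbhs (h : {ptws X -> X}) [set g : {ptws X -> X} | V (f (g x))].
  have /pointwise_cvgP/(_ x) := @cvg_id _ (nbhs (h : {ptws X -> X})).
  by move=> /(_ (f @^-1` V)); apply; apply: cf; rewrite hK.
have [_ [[n _ <-] /= Vn]] := clh _ nh.
have : (V `&` ~` periodic_point f) (iter n.+1 f x).
  by split=> // /(periodic_iter fK).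
by rewrite VP => xn; apply: nx; exists n.+1.
Qed.

End homeomorphisms.
(** * Six characterizations of equicontinuity *)

Theorem theorem5p6 (R : realType) (X : metricType R) (f : X -> X)
    (X_compact : compact [set: X]) (X_countable : countable [set: X])
    (f_homeo : homeomorphism f) :
  [<-> equicontinuous_system f;
       distal_system f;
       forall x : X, periodic_point f x;
       exists p : set_system nat,
         nonprincipal_ultrafilter p /\ homeomorphism (piter f p);
       forall e : R, 0 < e -> exists2 l : nat, (1 <= l)%N &
         forall (x : X) (n : nat), mdist x (iter (n * l)%N f x) < e;
       ellis_Z f = forward_orbit_closure f].
Proof.
have [h [cf ch fK hK]] := f_homeo.
split; first exact: (equicontinuous_distal fK hK).
split; first exact: (distal_periodic X_compact X_countable cf).
split; first exact: nonprincipal_piter_id.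
split.
  move=> [p [np gp]]; apply: (periodic_uniform_return (h := h)) => //.
  exact: (periodic_of_piter_homeomorphism X_compact X_countable cf fK np gp).
split; first exact: (uniform_return_ellis fK hK).
move=> Ef; apply: (periodic_equicontinuous (h := h)) => //.
exact: (ellis_periodic X_compact X_countable cf fK hK Ef).
Qed.
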